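(* Let $G=(V,E)$ be a simple, connected, undirected graph with at least one edge. Then all edges of $G$ are pairwise Laplacian-cospectral if and only if $G$ is edge-rigid.
   Context: For $a\in V$ let $e_a\in\mathbb{R}^V$ be the standard basis vector, for an edge $ab\in E$ let $z_{ab}=e_a-e_b$ and $L_{ab}=z_{ab}z_{ab}^T$, and let $L=\sum_{ab\in E}L_{ab}$ be the Laplacian of $G$. Two edges $ab,cd\in E$ are Laplacian-cospectral if $L-L_{ab}$ and $L-L_{cd}$ have the same characteristic polynomial. Define the linear map $\mathcal{L}^*$ from symmetric $V\times V$ matrices to $\mathbb{R}^E$ by $\mathcal{L}^*(X)_{ab}=X_{aa}+X_{bb}-2X_{ab}$. Let $L=\sum_{i=1}^r\lambda_iE_i$ be the spectral decomposition of $L$ with distinct eigenvalues $0=\lambda_1<\dots<\lambda_r$ and orthogonal eigenprojectors $E_i$. $G$ is edge-rigid if for every $i\in\{2,\dots,r\}$ there is $\gamma_i>0$ with $\mathcal{L}^*(E_i)=\gamma_i\mathbf{1}$, where $\mathbf{1}\in\mathbb{R}^E$ is the all-ones vector (equivalently, every canonical spectral embedding onto an eigenspace of a nonzero Laplacian eigenvalue has all edges of the same positive squared length). *)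

(* Defs.v *)
From mathcomp Require Import all_boot all_order all_algebra.
From mathcomp Require Import reals.

Set Implicit Arguments.
Unset Strict Implicit.
Unset Printing Implicit Defensive.

Import Order.TTheory GRing.Theory Num.Theory.

Local Open Scope ring_scope.

(* Vectors and matrices indexed by the vertex set V are indexed by 'I_#|V|,
   through the canonical bijection enum_rank : V -> 'I_#|V|. *)

Definition evec (R : realType) (V : finType) (a : V) : 'cV[R]_#|V| :=
  delta_mx (enum_rank a) 0.

Definition zvec (R : realType) (V : finType) (a b : V) : 'cV[R]_#|V| :=
  evec R a - evec R b.

Definition edge_laplacian (R : realType) (V : finType) (a b : V) :
    'M[R]_#|V| :=
  zvec R a b *m (zvec R a b)^T.

Lemma edge_laplacianC (R : realType) (V : finType) (a b : V) :
  edge_laplacian R a b = edge_laplacian R b a.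
Proof.
have zN : zvec R a b = - zvec R b a by rewrite /zvec opprB.
by rewrite /edge_laplacian zN linearN /= mulmxN mulNmx opprK.
Qed.

(* A simple graph is given by its adjacency relation. Each unordered edge has
   exactly one orientation (a, b) with enum_rank a < enum_rank b, hence
   contributes once to the sum; by edge_laplacianC the orientation is
   irrelevant. *)
Definition laplacian (R : realType) (V : finType) (adj : rel V) :
    'M[R]_#|V| :=
  \sum_(p : V * V | adj p.1 p.2 && (enum_rank p.1 < enum_rank p.2)%N)
    edge_laplacian R p.1 p.2.

Definition laplacian_cospectral (R : realType) (V : finType) (adj : rel V)
    (a b c d : V) : Prop :=
  char_poly (laplacian R adj - edge_laplacian R a b) =
  char_poly (laplacian R adj - edge_laplacian R c d).

(* The entry at ab of the vector L^*(X); it is symmetric in a and b when X is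
   a symmetric matrix. *)
Definition Lstar (R : realType) (V : finType) (X : 'M[R]_#|V|) (a b : V) : R :=
  X (enum_rank a) (enum_rank a) + X (enum_rank b) (enum_rank b)
  - X (enum_rank a) (enum_rank b) *+ 2.

(* The orthogonal projector onto the eigenspace of M at lam: the projection
   onto U := eigenspace M lam along kermx U^T, which is the orthogonal
   complement { v | v *m U^T = 0 } of U. Subspaces are row spaces here; this
   is immaterial, as M is the symmetric matrix laplacian R adj in what follows
   and the projector is itself symmetric (eigenproj_sym). *)
Definition eigenproj (R : realType) (n : nat) (M : 'M[R]_n) (lam : R) :
    'M[R]_n :=
  proj_mx (eigenspace M lam) (kermx (eigenspace M lam)^T).

Lemma capmx_orthogonal (R : realType) (n : nat) (U : 'M[R]_n) :
  (U :&: kermx U^T = 0)%MS.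
Proof.
apply/eqP/rowV0P => v; rewrite sub_capmx => /andP[/submxP[w vE] /sub_kermxP vU].
have /matrixP/(_ 0 0) : v *m v^T = 0.
  by rewrite {2}vE trmx_mul mulmxA vU mul0mx.
rewrite !mxE => /eqP; rewrite psumr_eq0; last first.
  by move=> j _; rewrite mxE -expr2 sqr_ge0.
move=> /allP v0; apply/rowP => j; rewrite mxE.
by have := v0 j (mem_index_enum j); rewrite mxE -expr2 sqrf_eq0 => /eqP.
Qed.

Lemma addsmx_orthogonal (R : realType) (n : nat) (U : 'M[R]_n) :
  row_full (U + kermx U^T)%MS.
Proof.
rewrite /row_full; have := mxrank_sum_cap U (kermx U^T).
rewrite capmx_orthogonal mxrank0 addn0 => ->.
by rewrite mxrank_ker mxrank_tr subnKC // rank_leq_row.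
Qed.

Lemma eigenproj_eigenspace (R : realType) (n : nat) (M : 'M[R]_n) (lam : R) :
  (eigenproj M lam :=: eigenspace M lam)%MS.
Proof.
set U := eigenspace M lam; apply/eqmxP/andP; split.
  by have := proj_mx_sub U (kermx U^T) 1%:M; rewrite mul1mx.
have <- : U *m eigenproj M lam = U.
  by apply: proj_mx_id; [exact: capmx_orthogonal | exact: submx_refl].
exact: submxMl.
Qed.

Lemma eigenproj_idem (R : realType) (n : nat) (M : 'M[R]_n) (lam : R) :
  eigenproj M lam *m eigenproj M lam = eigenproj M lam.
Proof. by apply: proj_mx_proj; exact: capmx_orthogonal. Qed.

Lemma eigenproj_sym (R : realType) (n : nat) (M : 'M[R]_n) (lam : R) :
  (eigenproj M lam)^T = eigenproj M lam.
Proof.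
set P := eigenproj M lam; set U := eigenspace M lam.
have PU : (P <= U)%MS by rewrite eigenproj_eigenspace submx_refl.
have QU : (1%:M - P) *m U^T = 0.
  apply/sub_kermxP.
  have := proj_mx_compl_sub (U := U) (V := kermx U^T) (W := 1%:M).
  by rewrite mul1mx; apply; rewrite submx_full // addsmx_orthogonal.
have PUT : P *m U^T = U^T.
  by apply/esym/eqP; rewrite -subr_eq0 -{1}[U^T]mul1mx -mulmxBl QU.
have PPT : P *m P^T = P^T.
  by have /submxP[D PE] := PU; rewrite {2 3}PE trmx_mul mulmxA PUT.
by have := congr1 trmx PPT; rewrite trmx_mul !trmxK PPT.
Qed.

(* The eigenvalues of the Laplacian other than 0 are the lambda_i with i >= 2,
   and eigenproj gives the corresponding projectors E_i. *)
Definition edge_rigid (R : realType) (V : finType) (adj : rel V) : Prop :=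
  forall lam : R, eigenvalue (laplacian R adj) lam -> lam != 0 ->
  exists2 gam : R, 0 < gam &
    forall a b : V, adj a b ->
      Lstar (eigenproj (laplacian R adj) lam) a b = gam.

(* Main.v *)
Require Import Defs.
From mathcomp Require Import all_boot all_order all_algebra.
From mathcomp Require Import reals.
From mathcomp Require Import complex.

(**
  With [q = \prod_r ('X - r)] over the eigenvalues [r] of [L] and
  [q_r = q / ('X - r)], the matrix [\sum_r q_r E_r] is [q] times the inverse of
  ['X - L]. By the matrix determinant lemma
    [q * char_poly (L - z z^T) = char_poly L * (q + \sum_r (z^T E_r z) q_r)],
  and the [q_r] are linearly independent, so the characteristic polynomial of
  [L - L_ab] and the numbers [z_ab^T E_r z_ab = L^*(E_r)_ab] determine each
  other. The eigenvalue [0] plays no role, as the Laplacian kernel is orthogonal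
  to every [z_ab]. If [L^*(E_r)] vanished on the edges, then [E_r z_ab = 0] for
  every edge, so that [r E_r = E_r L = 0].
*)

Set Implicit Arguments.
Unset Strict Implicit.
Unset Printing Implicit Defensive.

Import Order.TTheory GRing.Theory Num.Theory.

Local Open Scope ring_scope.

(** The matrix determinant lemma without division: [B] stands for [q] times the inverse of [A]. The
    bordered matrix [M] is reduced in two ways, and [\det B] cancels since it divides the nonzero
    [q ^+ n]. *)
Lemma det_add_rank1 (D : idomainType) (n : nat) (q : D) (A B : 'M[D]_n)
    (u : 'cV[D]_n) (v : 'rV[D]_n) :
  q != 0 -> A *m B = q%:M ->
  q * \det (A + u *m v) = \det A * (q + (v *m B *m u) 0 0).
Proof.
move=> q0 AB; pose M := block_mx A (- u) v (1%:M : 'M_1).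
have detAB : \det A * \det B = q ^+ n by rewrite -det_mulmx AB det_scalar.
have detB0 : \det B != 0.
  have: q ^+ n != 0 by rewrite expf_neq0.
  by rewrite -detAB mulf_eq0 => /norP[].
have detM : \det M = \det (A + u *m v).
  (* Column operations clear [v]. *)
  have ME : M *m block_mx 1%:M 0 (- v) 1%:M = block_mx (A + u *m v) (- u) 0 1%:M.
    rewrite mulmx_block !mulmx1 !mulmx0 !mul1mx mulNmx mulmxN opprK.
    by rewrite subrr !add0r.
  have := congr1 determinant ME.
  by rewrite det_mulmx det_lblock det_ublock !det1 !mulr1.
have detMB : \det M * (\det B * q) = q ^+ n * (q + (v *m B *m u) 0 0).
  (* Column operations clear [- u], at the cost of the factor [\det B * q]. *)
  have ME : M *m block_mx B (B *m u) 0 (q%:M : 'M_1) =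
      block_mx q%:M 0 (v *m B) (v *m B *m u + q%:M).
    rewrite mulmx_block !mulmx0 !addr0 !mul1mx !mulmxA AB.
    by rewrite mul_scalar_mx mul_mx_scalar scalerN subrr.
  have := congr1 determinant ME.
  rewrite det_mulmx det_ublock det_lblock !det_scalar !expr1 => ->.
  by rewrite (mx11_scalar (v *m B *m u + _)) det_scalar expr1 !mxE mulr1n addrC.
apply: (mulIf detB0); rewrite -detM [q * _]mulrC -mulrA [q * _]mulrC detMB.
by rewrite -detAB mulrAC.
Qed.

(** * Spectral decomposition of a real symmetric matrix *)

Section SymmetricSpectrum.
Variables (R : realType) (n : nat) (A : 'M[R]_n).
Hypothesis A_sym : A^T = A.

Lemma eigenproj_mulr lam : eigenproj A lam *m A = lam *: eigenproj A lam.
Proof. by apply/eigenspaceP; rewrite eigenproj_eigenspace. Qed.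

Lemma eigenproj_mull lam : A *m eigenproj A lam = lam *: eigenproj A lam.
Proof.
have /(congr1 trmx) := eigenproj_mulr lam.
by rewrite trmx_mul linearZ /= eigenproj_sym A_sym.
Qed.

Lemma eigenspace_eigenproj lam :
  eigenspace A lam *m eigenproj A lam = eigenspace A lam.
Proof. by apply: proj_mx_id => //; exact: capmx_orthogonal. Qed.

(** With [U] the eigenspace at [lam] and [P] the projector at [mu], [U *m A *m P] is both
    [lam *: (U *m P)] and [mu *: (U *m P)]. *)
Lemma eigenspace_eigenproj_neq lam mu :
  lam != mu -> eigenspace A lam *m eigenproj A mu = 0.
Proof.
move=> neq; set U := eigenspace A lam.
have UA : U *m A = lam *: U by apply/eigenspaceP.
apply/eqP; have : U *m A *m eigenproj A mu = U *m (A *m eigenproj A mu).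
  by rewrite -mulmxA.
rewrite UA eigenproj_mull -scalemxAl -scalemxAr => /eqP.
by rewrite -subr_eq0 -scalerBl scaler_eq0 subr_eq0 (negbTE neq).
Qed.

(** Over [R[i]] the matrix is Hermitian, so an invertible [P] whose rows are eigenvectors for real
    eigenvalues exists. The defect [Q] of the sum kills every real eigenspace involved, hence every
    row of [P], hence is zero. *)
Lemma sum_eigenproj :
  exists2 rs, uniq rs & \sum_(r <- rs) eigenproj A r = 1%:M.
Proof.
pose toC : {rmorphism R -> R[i]%C} := real_complex R.
pose A' := map_mx toC A.
have A'herm : A' \is hermsymmx.
  apply/is_hermitianmxP; rewrite expr0 scale1r.
  by apply/matrixP=> i j; rewrite !mxE conj_Creal ?complex_real // -{1}A_sym mxE.
have /orthomx_spectralP A'E := hermitian_normalmx A'herm.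
set P := spectralmx A' in A'E; set d := spectral_diag A' in A'E.
have Punit : P \in unitmx by exact: spectral_unit.
have PA' : P *m A' = diag_mx d *m P by rewrite {1}A'E !mulmxA mulmxV // mul1mx.
pose re j := complex.Re (d 0 j).
have dE j : d 0 j = toC (re j).
  have /mxOverP/(_ 0 j) := hermitian_spectral_diag_real A'herm.
  by move=> /RRe_real.
exists (undup [seq re j | j <- enum 'I_n]); first exact: undup_uniq.
set rs := undup _; apply/esym/eqP; rewrite -subr_eq0; set Q := _ - _.
have UQ r : r \in rs -> eigenspace A r *m Q = 0.
  move=> r_rs; rewrite mulmxBr mulmx1 mulmx_sumr.
  rewrite (bigD1_seq r) ?undup_uniq //= eigenspace_eigenproj big1 ?addr0 ?subrr //.
  by move=> s sr; rewrite eigenspace_eigenproj_neq // eq_sym.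
rewrite -(map_mx_eq0 toC) -/Q.
suff PQ : P *m map_mx toC Q = 0 by rewrite -(mulKmx Punit (map_mx _ _)) PQ mulmx0.
apply/row_matrixP => j; rewrite row_mul row0.
have : (row j P <= eigenspace A' (d 0 j))%MS.
  by apply/eigenspaceP; rewrite -row_mul PA'; apply/rowP => k; rewrite mul_diag_mx !mxE.
(* As the eigenvalue is real, its complex eigenspace is spanned by the real one. *)
rewrite dE -map_eigenspace => /submxP[w ->].
rewrite -mulmxA -map_mxM UQ ?map_mx0 ?mulmx0 //.
by rewrite mem_undup; apply: map_f; rewrite mem_enum.
Qed.

(** * Characteristic polynomial of a rank-one perturbation *)

Section RankOne.
Variables (rs : seq R) (rs_uniq : uniq rs).
Hypothesis rs_sum : \sum_(r <- rs) eigenproj A r = 1%:M.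

(** Multiplying the resolution of the identity by the projector at [lam] leaves only products for
    distinct values, all zero. So [rs] contains the whole spectrum. *)
Lemma eigenproj_eq0 lam : lam \notin rs -> eigenproj A lam = 0.
Proof.
move=> lam_rs; rewrite -[LHS]mulmx1 -rs_sum mulmx_sumr big1_seq // => r /andP[_ r_rs].
have [D ->] : exists D, eigenproj A lam = D *m eigenspace A lam.
  by apply/submxP; rewrite eigenproj_eigenspace.
rewrite -mulmxA eigenspace_eigenproj_neq ?mulmx0 //.
by apply: contraNneq lam_rs => ->.
Qed.

Let q : {poly R} := \prod_(r <- rs) ('X - r%:P).
Let q_ (r : R) : {poly R} := \prod_(s <- rs | s != r) ('X - s%:P).

Lemma char_poly_sub_rank1 (z : 'cV[R]_n) :
  q * char_poly (A - z *m z^T) = char_poly A *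
    (q + \sum_(r <- rs) ((z^T *m eigenproj A r *m z) 0 0)%:P * q_ r).
Proof.
pose C m p (M : 'M[R]_(m, p)) := map_mx polyC M.
pose B : 'M[{poly R}]_n := \sum_(r <- rs) q_ r *: C _ _ (eigenproj A r).
have q0 : q != 0 by apply/monic_neq0/monic_prod_XsubC.
(* On the image of the projector at [r], ['X - A] acts as ['X - r], which completes [q_ r] to
   [q]. *)
have AB : char_poly_mx A *m B = q%:M.
  rewrite mulmx_sumr -[q%:M]mulmx1 -(map_mx1 polyC) -rs_sum map_mx_sum mulmx_sumr.
  apply: eq_big_seq => r r_rs.
  rewrite -scalemxAr mulmxBl -map_mxM eigenproj_mull map_mxZ !mul_scalar_mx.
  by rewrite -scalerBl scalerA mulrC /q (bigD1_seq r).
have := det_add_rank1 (C _ _ z) (C _ _ z^T) q0 AB.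
have -> : char_poly_mx A + C _ _ z *m C _ _ z^T = char_poly_mx (A - z *m z^T).
  by rewrite /char_poly_mx map_mxB map_mxM opprB addrA addrAC.
move=> ->; congr (_ * (_ + _)).
rewrite mulmx_sumr mulmx_suml summxE; apply: eq_bigr => r _.
by rewrite -scalemxAr -scalemxAl -!map_mxM !mxE mulrC.
Qed.

(* At [r], the sum [\sum_s c_s q_s] takes the value [c_r q_r(r)]. *)
Lemma sum_q_inj (c d : R -> R) :
  \sum_(r <- rs) (c r)%:P * q_ r = \sum_(r <- rs) (d r)%:P * q_ r ->
  {in rs, c =1 d}.
Proof.
move=> eq_cd r r_rs.
have q_r : (q_ r).[r] != 0.
  rewrite horner_prod prodf_seq_neq0; apply/allP => s _; apply/implyP => sr.
  by rewrite hornerXsubC subr_eq0 eq_sym.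
have ev (e : R -> R) : (\sum_(s <- rs) (e s)%:P * q_ s).[r] = e r * (q_ r).[r].
  rewrite horner_sum (bigD1_seq r) //= hornerCM big1 ?addr0 // => s sr.
  rewrite hornerCM /q_ -big_filter (bigD1_seq r) ?filter_uniq //=; last first.
    by rewrite mem_filter r_rs eq_sym sr.
  by rewrite hornerM hornerXsubC subrr mul0r mulr0.
by apply: (mulIf q_r); rewrite -!ev eq_cd.
Qed.

(** Both [q] and [char_poly A] are monic, so they cancel in [char_poly_sub_rank1]. Outside [rs] the
    projector is zero, which allows [lam] to be arbitrary. *)
Lemma char_poly_sub_rank1_eq (y z : 'cV[R]_n) :
  char_poly (A - y *m y^T) = char_poly (A - z *m z^T) <->
  forall lam, y^T *m eigenproj A lam *m y = z^T *m eigenproj A lam *m z.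
Proof.
have q0 : q != 0 by apply/monic_neq0/monic_prod_XsubC.
split=> [eq_yz lam | eq_yz]; last first.
  apply: (mulfI q0); rewrite !char_poly_sub_rank1; congr (_ * (_ + _)).
  by apply: eq_bigr => r _; rewrite eq_yz.
have [lam_rs | /eigenproj_eq0 ->] := boolP (lam \in rs); last first.
  by rewrite !mulmx0 !mul0mx.
have : q * char_poly (A - y *m y^T) = q * char_poly (A - z *m z^T) by rewrite eq_yz.
rewrite !char_poly_sub_rank1 => /(mulfI (monic_neq0 (char_poly_monic A))) /addrI.
move=> /sum_q_inj /(_ _ lam_rs) eq_lam.
by apply/matrixP => i j; rewrite !ord1.
Qed.

End RankOne.
End SymmetricSpectrum.

Lemma mulmx_tr_self_ge0 (R : realDomainType) (n : nat) (v : 'cV[R]_n) :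
  0 <= (v^T *m v) 0 0.
Proof. by rewrite mxE sumr_ge0 // => i _; rewrite mxE -expr2 sqr_ge0. Qed.

Lemma mulmx_tr_self_eq0 (R : realDomainType) (n : nat) (v : 'cV[R]_n) :
  ((v^T *m v) 0 0 == 0) = (v == 0).
Proof.
apply/eqP/eqP => [|->]; last by rewrite mulmx0 mxE.
rewrite mxE => /eqP; rewrite psumr_eq0; last first.
  by move=> j _; rewrite mxE -expr2 sqr_ge0.
move=> /allP v0; apply/colP => j; rewrite mxE.
by have := v0 j (mem_index_enum j); rewrite mxE -expr2 sqrf_eq0 => /eqP.
Qed.

(** * Edge vectors and the graph Laplacian *)

Section Graph.
Variables (R : realType) (V : finType) (adj : rel V).

Lemma laplacian_sym : (laplacian R adj)^T = laplacian R adj.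
Proof.
rewrite /laplacian raddf_sum /=; apply: eq_bigr => p _.
by rewrite trmx_mul trmxK.
Qed.

Lemma Lstar_quadratic (X : 'M[R]_#|V|) (a b : V) :
  X^T = X -> Lstar X a b = ((zvec R a b)^T *m X *m zvec R a b) 0 0.
Proof.
move=> X_sym; have XE i j : X j i = X i j by rewrite -{1}X_sym mxE.
rewrite /zvec /evec [(_ - _)^T]linearB /= !trmx_delta mulmxBl mulmxBl !mulmxBr -!rowE -!colE !mxE.
by rewrite /Lstar (XE (enum_rank a) (enum_rank b)) mulr2n opprB [in RHS]addrACA -opprD.
Qed.

(** A symmetric idempotent turns the quadratic form into a squared length, which is nonnegative and
    vanishes only with the projected vector. *)
Lemma Lstar_eigenproj lam (a b : V) :
  let P := eigenproj (laplacian R adj) lam in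
  Lstar P a b = ((P *m zvec R a b)^T *m (P *m zvec R a b)) 0 0.
Proof.
move=> P; rewrite Lstar_quadratic ?eigenproj_sym // trmx_mul eigenproj_sym.
by rewrite -mulmxA [in RHS]mulmxA -(mulmxA _ P P) eigenproj_idem -mulmxA.
Qed.

Hypotheses (adj_sym : symmetric adj) (adj_irr : irreflexive adj).

(** [laplacian] sums over the increasing orientation of each edge only; this transfers a symmetric
    property to both orientations. *)
Lemma adj_oriented (Q : V -> V -> Prop) :
    (forall a b, Q a b -> Q b a) ->
    (forall a b, adj a b -> (enum_rank a < enum_rank b)%N -> Q a b) ->
  forall a b, adj a b -> Q a b.
Proof.
move=> Qsym Qlt a b ab; case: (ltngtP (enum_rank a) (enum_rank b)).
- exact: Qlt.
- by move=> ba; apply/Qsym/Qlt; rewrite ?(adj_sym b a).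
- by move=> /val_inj/enum_rank_inj eq_ab; rewrite eq_ab adj_irr in ab.
Qed.

Lemma zvecC (a b : V) : zvec R b a = - zvec R a b.
Proof. by rewrite /zvec opprB. Qed.

(** [w^T *m L *m w] is the sum over the edges of the squares of [z^T *m w]; if it is zero, so is
    each square. *)
Lemma kernel_laplacian_zvec (w : 'cV[R]_#|V|) :
  laplacian R adj *m w = 0 ->
  forall a b, adj a b -> (zvec R a b)^T *m w = 0.
Proof.
move=> Lw0; apply: adj_oriented => [a b|a b ab lt_ab].
  by rewrite (zvecC a b) linearN mulNmx => /= ->; rewrite oppr0.
pose s (p : V * V) := ((((zvec R p.1 p.2)^T *m w)^T *m ((zvec R p.1 p.2)^T *m w)) 0 0).
have : \sum_(p : V * V | adj p.1 p.2 && (enum_rank p.1 < enum_rank p.2)%N) s p == 0.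
  rewrite (_ : \sum_(p | _) _ = (w^T *m (laplacian R adj *m w)) 0 0).
    by rewrite Lw0 mulmx0 mxE.
  rewrite /laplacian mulmx_suml mulmx_sumr summxE; apply: eq_bigr => p _.
  by rewrite /s trmx_mul trmxK !mulmxA.
rewrite psumr_eq0 => [|p _]; last exact: mulmx_tr_self_ge0.
move=> /allP/(_ (a, b) (mem_index_enum _)) /=; rewrite ab lt_ab /=.
by rewrite mulmx_tr_self_eq0 => /eqP.
Qed.

Lemma Lstar_eigenproj0 (a b : V) :
  adj a b -> Lstar (eigenproj (laplacian R adj) 0) a b = 0.
Proof.
move=> ab; rewrite Lstar_quadratic ?eigenproj_sym // -mulmxA.
rewrite (kernel_laplacian_zvec _ ab) ?mxE // mulmxA.
by rewrite (eigenproj_mull laplacian_sym) scale0r mul0mx.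
Qed.

Lemma Lstar_eigenproj_eq0 lam :
    (forall a b, adj a b -> Lstar (eigenproj (laplacian R adj) lam) a b = 0) ->
  lam != 0 -> ~~ eigenvalue (laplacian R adj) lam.
Proof.
set P := eigenproj _ _ => Lstar0 lam0.
have PL : P *m laplacian R adj = 0.
  rewrite mulmx_sumr big1 // => -[a b] /= /andP[ab _].
  suff Pz : P *m zvec R a b = 0 by rewrite mulmxA Pz mul0mx.
  by apply/eqP; rewrite -mulmx_tr_self_eq0 -Lstar_eigenproj Lstar0.
have P0 : P = 0.
  by move/eqP: PL; rewrite eigenproj_mulr scaler_eq0 (negbTE lam0) => /eqP.
rewrite negbK -submx0 -eigenproj_eigenspace.
by rewrite -/P P0 submx_refl.
Qed.

Lemma laplacian_cospectralP (a b c d : V) :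
  laplacian_cospectral R adj a b c d <->
  forall lam, Lstar (eigenproj (laplacian R adj) lam) a b =
              Lstar (eigenproj (laplacian R adj) lam) c d.
Proof.
have [rs rs_uniq rs_sum] := sum_eigenproj laplacian_sym.
apply: (iff_trans (char_poly_sub_rank1_eq laplacian_sym rs_uniq rs_sum _ _)).
split=> eq_lam lam; first by rewrite !Lstar_quadratic ?eigenproj_sym // eq_lam.
apply/matrixP => i j; rewrite !ord1.
by rewrite -!Lstar_quadratic ?eigenproj_sym // eq_lam.
Qed.

End Graph.

Theorem mainTheorem1 (R : realType) (V : finType) (adj : rel V)
    (adj_sym : symmetric adj) (adj_irr : irreflexive adj)
    (adj_conn : forall x y : V, connect adj x y)
    (adj_edge : exists a b : V, adj a b) :
  (forall a b c d : V, adj a b -> adj c d ->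
     laplacian_cospectral R adj a b c d)
  <-> edge_rigid R adj.
Proof.
split=> [cosp lam eig lam0 | rigid a b c d ab cd].
  have [a [b ab]] := adj_edge.
  have Lstar_ab c d : adj c d -> Lstar (eigenproj (laplacian R adj) lam) c d =
      Lstar (eigenproj (laplacian R adj) lam) a b.
    by move=> cd; have /laplacian_cospectralP := cosp _ _ _ _ cd ab; apply.
  (* The common value is read off at one edge. It is a squared length, and were it zero, it would be
     zero on all edges and [lam] would not be an eigenvalue. *)
  exists (Lstar (eigenproj (laplacian R adj) lam) a b) => //.
  rewrite lt_def Lstar_eigenproj mulmx_tr_self_ge0 -Lstar_eigenproj andbT.
  apply: contraL eig => /eqP Lstar0; apply: Lstar_eigenproj_eq0 => // c d cd.
  by rewrite Lstar_ab.
apply/laplacian_cospectralP => lam.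
(* Rigidity only speaks of nonzero eigenvalues; at [0] and at non-eigenvalues both sides are
   zero. *)
have [-> | lam0] := eqVneq lam 0; first by rewrite !Lstar_eigenproj0.
have [eig | /negPn/eqP eig0] := boolP (eigenvalue (laplacian R adj) lam).
  by have [gam _ gamE] := rigid lam eig lam0; rewrite !gamE.
suff -> : eigenproj (laplacian R adj) lam = 0 by rewrite /Lstar !mxE.
by apply/eqP; rewrite -submx0 eigenproj_eigenspace eig0.
Qed.
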